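(* Let $m,n\ge 2$ and let $\mathcal{A}=(a_{i_1j_1i_2j_2})\in\mathbb{R}^{m\times n\times m\times n}$ be a biquadratic tensor (no symmetry assumed). Then $\mathcal{A}$ always has at least one M-eigenvalue. Furthermore, $\mathcal{A}$ is positive semi-definite if and only if all of its M-eigenvalues are nonnegative, and $\mathcal{A}$ is positive definite if and only if all of its M-eigenvalues are positive.
   Context: Write $[n]=\{1,\dots,n\}$. A biquadratic tensor is a real fourth-order tensor $\mathcal{A}=(a_{i_1j_1i_2j_2})\in\mathbb{R}^{m\times n\times m\times n}$, with $i_1,i_2\in[m]$, $j_1,j_2\in[n]$ and $m,n\ge2$; the set of these is $BQ(m,n)$. Put $f(\mathbf{x},\mathbf{y})=\sum_{i_1,i_2=1}^m\sum_{j_1,j_2=1}^n a_{i_1j_1i_2j_2}x_{i_1}y_{j_1}x_{i_2}y_{j_2}$. $\mathcal{A}$ is positive semi-definite if $f(\mathbf{x},\mathbf{y})\ge0$ for all $\mathbf{x}\in\mathbb{R}^m,\mathbf{y}\in\mathbb{R}^n$, and positive definite if $f(\mathbf{x},\mathbf{y})>0$ for all $\mathbf{x}\in\mathbb{R}^m,\mathbf{y}\in\mathbb{R}^n$ with $\mathbf{x}^\top\mathbf{x}=\mathbf{y}^\top\mathbf{y}=1$. A real number $\lambda$ is an M-eigenvalue of $\mathcal{A}$ if there are real vectors $\mathbf{x}\in\mathbb{R}^m$, $\mathbf{y}\in\mathbb{R}^n$ (the corresponding M-eigenvectors) with $\mathbf{x}^\top\mathbf{x}=\mathbf{y}^\top\mathbf{y}=1$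 such that for every $i\in[m]$ $$\sum_{i_1=1}^m\sum_{j_1,j_2=1}^n a_{i_1j_1ij_2}x_{i_1}y_{j_1}y_{j_2}+\sum_{i_2=1}^m\sum_{j_1,j_2=1}^n a_{ij_1i_2j_2}y_{j_1}x_{i_2}y_{j_2}=2\lambda x_i,$$ and for every $j\in[n]$ $$\sum_{i_1,i_2=1}^m\sum_{j_1=1}^n a_{i_1j_1i_2j}x_{i_1}y_{j_1}x_{i_2}+\sum_{i_1,i_2=1}^m\sum_{j_2=1}^n a_{i_1ji_2j_2}x_{i_1}x_{i_2}y_{j_2}=2\lambda y_j.$$ *)

(* Defs.v *)
From mathcomp Require Import all_boot all_order all_algebra.
From mathcomp Require Import reals.

Set Implicit Arguments.
Unset Strict Implicit.
Unset Printing Implicit Defensive.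

Import Order.TTheory GRing.Theory Num.Theory.
Local Open Scope ring_scope.

(* [A i1 j1 i2 j2] is the entry a_{i1 j1 i2 j2}; indices run over {0, .., m-1} and
   {0, .., n-1}.  No symmetry is imposed. *)
Definition biquadratic_tensor (R : realType) (m n : nat) : Type :=
  'I_m -> 'I_n -> 'I_m -> 'I_n -> R.

Definition biquadratic_form (R : realType) (m n : nat)
    (A : biquadratic_tensor R m n) (x : 'cV[R]_m) (y : 'cV[R]_n) : R :=
  \sum_(i1 < m) \sum_(i2 < m) \sum_(j1 < n) \sum_(j2 < n)
    A i1 j1 i2 j2 * x i1 0 * y j1 0 * x i2 0 * y j2 0.

Definition unit_vector (R : realType) (k : nat) (x : 'cV[R]_k) : Prop :=
  (x^T *m x) 0 0 = 1.

Definition positive_semidefinite (R : realType) (m n : nat)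
    (A : biquadratic_tensor R m n) : Prop :=
  forall (x : 'cV[R]_m) (y : 'cV[R]_n), 0 <= biquadratic_form A x y.

Definition positive_definite (R : realType) (m n : nat)
    (A : biquadratic_tensor R m n) : Prop :=
  forall (x : 'cV[R]_m) (y : 'cV[R]_n),
    unit_vector x -> unit_vector y -> 0 < biquadratic_form A x y.

Definition M_eigenpair (R : realType) (m n : nat) (A : biquadratic_tensor R m n)
    (lambda : R) (x : 'cV[R]_m) (y : 'cV[R]_n) : Prop :=
  [/\ unit_vector x,
      unit_vector y,
      forall i : 'I_m,
        \sum_(i1 < m) \sum_(j1 < n) \sum_(j2 < n)
          A i1 j1 i j2 * x i1 0 * y j1 0 * y j2 0
        + \sum_(i2 < m) \sum_(j1 < n) \sum_(j2 < n)
            A i j1 i2 j2 * y j1 0 * x i2 0 * y j2 0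
        = 2 * lambda * x i 0
    & forall j : 'I_n,
        \sum_(i1 < m) \sum_(i2 < m) \sum_(j1 < n)
          A i1 j1 i2 j * x i1 0 * y j1 0 * x i2 0
        + \sum_(i1 < m) \sum_(i2 < m) \sum_(j2 < n)
            A i1 j i2 j2 * x i1 0 * x i2 0 * y j2 0
        = 2 * lambda * y j 0].

Definition M_eigenvalue (R : realType) (m n : nat) (A : biquadratic_tensor R m n)
    (lambda : R) : Prop :=
  exists (x : 'cV[R]_m) (y : 'cV[R]_n), M_eigenpair A lambda x y.

(* Main.v *)
Require Import Defs.
From mathcomp Require Import all_boot all_order all_algebra.
From mathcomp Require Import reals.
From mathcomp Require Import ring lra.
From mathcomp Require Import boolp classical_sets topology normedtype derive.

Import Order.TTheory GRing.Theory Num.Theory.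
Import numFieldNormedType.Exports.
Local Open Scope ring_scope.

(** An M-eigenvalue is a value of the biquadratic form at a pair of unit vectors
which is critical in each of its two arguments, so the theorem follows once the
minimum of the form over pairs of unit vectors is known to exist and to be an
M-eigenvalue.

The minimum [l] exists by compactness of the product of the two unit spheres,
and is attained at some [(x, y)] ([biquadratic_form_min]).  For [y] fixed the
form is a quadratic form [quad B] in its first argument, and subtracting [l]
times the square norm gives a quadratic form that is nonnegative everywhere, by
homogeneity, and zero at [x].  A nonnegative quadratic form has zero gradient at
its zeros ([psd_gradient_eq0]), which is the first half of the M-eigenvalue
equations; the other half is the same argument with [x] fixed
([exists_minimal_M_eigenpair]).

Conversely, contracting the first half of the equations with [x] shows that the
M-eigenvalue of an eigenpair [(x, y)] is the value of the form there
([M_eigenpair_form]).  Hence all M-eigenvalues are nonnegative (resp.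
positive) as soon as the form is on pairs of unit vectors, and if the
M-eigenvalue [l] is nonnegative (resp. positive), so is the form on all pairs of
unit vectors; nonnegativity then extends to all pairs of vectors by
homogeneity. *)

(** * Quadratic forms *)

Section QuadraticForms.
Context {R : realType}.

Lemma trmx11E (M : 'M[R]_1) : M^T 0 0 = M 0 0.
Proof. by rewrite mxE. Qed.

Lemma sqnormE {k} (x : 'cV[R]_k) : (x^T *m x) 0 0 = \sum_i x i 0 ^+ 2.
Proof. by rewrite mxE; apply: eq_bigr => i _; rewrite mxE expr2. Qed.

Lemma sqnorm_ge0 {k} (x : 'cV[R]_k) : 0 <= (x^T *m x) 0 0.
Proof. by rewrite sqnormE sumr_ge0// => i _; exact: sqr_ge0. Qed.

Lemma sqnorm_eq0 {k} (x : 'cV[R]_k) : (x^T *m x) 0 0 = 0 -> x = 0.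
Proof.
rewrite sqnormE => /psumr_eq0P x0; apply/colP => i; rewrite mxE.
by apply/eqP; rewrite -sqrf_eq0 x0// => j _; exact: sqr_ge0.
Qed.

Lemma sqnormZ {k} a (x : 'cV[R]_k) :
  ((a *: x)^T *m (a *: x)) 0 0 = a ^+ 2 * (x^T *m x) 0 0.
Proof. by rewrite !sqnormE mulr_sumr; apply: eq_bigr => i _; rewrite mxE exprMn. Qed.

(** Polar decomposition; the zero vector is [0] times any unit vector. *)
Lemma scale_unit_vector {k} (x : 'cV[R]_k) : (0 < k)%N ->
  exists a u, unit_vector u /\ x = a *: u.
Proof.
case: k x => // k x _; have [->|x0] := eqVneq x 0.
  exists 0, (delta_mx 0 0); split; last by rewrite scale0r.
  rewrite /unit_vector sqnormE (bigD1 0)//= big1 => [|i /negPf i0].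
    by rewrite mxE !eqxx expr1n addr0.
  by rewrite mxE i0 expr0n.
have s0 : 0 < (x^T *m x) 0 0.
  rewrite lt_neqAle sqnorm_ge0 andbT eq_sym.
  by apply: contra_neq x0; exact: sqnorm_eq0.
have r0 : Num.sqrt ((x^T *m x) 0 0) != 0 by rewrite sqrtr_eq0 -ltNge.
exists (Num.sqrt ((x^T *m x) 0 0)), ((Num.sqrt ((x^T *m x) 0 0))^-1 *: x).
split; last by rewrite scalerA divff// scale1r.
by rewrite /unit_vector sqnormZ exprVn sqr_sqrtr ?sqnorm_ge0// mulVf// gt_eqF.
Qed.

(** The quadratic form of a matrix that need not be symmetric; its gradient at [x]
    is therefore [(B^T + B) *m x]. *)
Definition quad {k} (B : 'M[R]_k) (x : 'cV[R]_k) : R := (x^T *m (B *m x)) 0 0.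

Lemma quadE {k} (B : 'M[R]_k) x :
  quad B x = \sum_i \sum_j B i j * x i 0 * x j 0.
Proof.
rewrite /quad mxE; apply: eq_bigr => i _.
by rewrite !mxE mulr_sumr; apply: eq_bigr => j _; ring.
Qed.

Lemma quad_tr {k} (B : 'M[R]_k) x : quad B^T x = quad B x.
Proof. by rewrite /quad -trmx11E !trmx_mul !trmxK mulmxA. Qed.

Lemma quad_shift {k} (B : 'M[R]_k) l x :
  quad (B - l%:M) x = quad B x - l * (x^T *m x) 0 0.
Proof.
by rewrite /quad mulmxBl mulmxBr mul_scalar_mx -scalemxAr mxE [X in _ + X]mxE [X in - X]mxE.
Qed.

(** Expansion of a quadratic form along the line through [x] directed by [v]. *)
Lemma quad_line {k} (B : 'M[R]_k) x v t :
  quad B (x + t *: v) =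
  quad B x + t * (v^T *m ((B^T + B) *m x)) 0 0 + t ^+ 2 * quad B v.
Proof.
have xBv : (x^T *m (B *m v)) 0 0 = (v^T *m (B^T *m x)) 0 0.
  by rewrite -trmx11E !trmx_mul trmxK mulmxA.
have DE (M N : 'M[R]_1) : (M + N) 0 0 = M 0 0 + N 0 0 by rewrite mxE.
have ZE c (M : 'M[R]_1) : (c *: M) 0 0 = c * M 0 0 by rewrite mxE.
rewrite /quad [in LHS]linearD/= [in LHS]linearZ/= !(mulmxDl, mulmxDr).
by rewrite -!(scalemxAl, scalemxAr) !(DE, ZE) xBv; ring.
Qed.

(** A zero of a nonnegative quadratic form minimizes it, hence is critical. *)
Lemma psd_gradient_eq0 {k} (D : 'M[R]_k) x :
  (forall v, 0 <= quad D v) -> quad D x = 0 -> (D^T + D) *m x = 0.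
Proof.
move=> D0 Dx0; set w := _ *m x; apply: sqnorm_eq0.
have := D0 w; set q := quad D w => q0.
set s := (w^T *m w) 0 0.
(* The value at x + t *: w is t * s + t ^+ 2 * q, where s is the square norm of
   w; taking t = - s / (1 + q) makes it - (s / (1 + q)) ^+ 2. *)
have := D0 (x + (- s / (1 + q)) *: w).
rewrite quad_line Dx0 add0r -/w -/s -/q.
have q1 : 1 + q != 0 by rewrite gt_eqF// ltr_wpDr.
have -> : - s / (1 + q) * s + (- s / (1 + q)) ^+ 2 * q = - (s / (1 + q)) ^+ 2.
  by field.
rewrite oppr_ge0 => le0; apply/eqP.
have : (s / (1 + q)) ^+ 2 == 0 by rewrite eq_le le0 sqr_ge0.
by rewrite sqrf_eq0 mulf_eq0 invr_eq0 (negPf q1) orbF.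
Qed.

(** The Lagrange multiplier equation at a minimum on the unit sphere; by
    homogeneity, minimality is stated as a bound on all vectors. *)
Lemma quad_min_eigen {k} (B : 'M[R]_k) l x : unit_vector x ->
  (forall v, l * (v^T *m v) 0 0 <= quad B v) -> quad B x = l ->
  (B^T + B) *m x = (2 * l) *: x.
Proof.
move=> x1 minB Bx.
have /psd_gradient_eq0 : forall v, 0 <= quad (B - l%:M) v.
  by move=> v; rewrite quad_shift subr_ge0.
move=> /(_ x); rewrite quad_shift Bx x1 mulr1 subrr => /(_ erefl).
rewrite linearB/= tr_scalar_mx !(mulmxDl, mulNmx) !mul_scalar_mx => /eqP.
rewrite addrACA -opprD subr_eq0 => /eqP ->.
by rewrite -scalerDl mulr_natl mulr2n.
Qed.

End QuadraticForms.

(** * Slices of a biquadratic form *)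

Section Slices.
Context {R : realType} {m n : nat}.
Context (A : biquadratic_tensor R m n).
Implicit Types (x : 'cV[R]_m) (y : 'cV[R]_n).

(** Matrix, in general not symmetric, of the quadratic form
    [biquadratic_form A ^~ y]. *)
Definition slice1 y : 'M[R]_m :=
  \matrix_(i1, i2) \sum_(j1 < n) \sum_(j2 < n) A i1 j1 i2 j2 * y j1 0 * y j2 0.

(** Matrix, in general not symmetric, of the quadratic form
    [biquadratic_form A x]. *)
Definition slice2 x : 'M[R]_n :=
  \matrix_(j1, j2) \sum_(i1 < m) \sum_(i2 < m) A i1 j1 i2 j2 * x i1 0 * x i2 0.

Lemma quad_slice1 x y : quad (slice1 y) x = biquadratic_form A x y.
Proof.
rewrite quadE; apply: eq_bigr => i1 _; apply: eq_bigr => i2 _.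
rewrite mxE !mulr_suml; apply: eq_bigr => j1 _.
by rewrite !mulr_suml; apply: eq_bigr => j2 _; ring.
Qed.

Lemma quad_slice2 x y : quad (slice2 x) y = biquadratic_form A x y.
Proof.
rewrite quadE /biquadratic_form pair_big/= [RHS]pair_big/=.
under eq_bigr => p _.
  rewrite mxE pair_big/= !mulr_suml; over.
rewrite exchange_big/=; apply: eq_bigr => p _.
by rewrite pair_big/=; apply: eq_bigr => q _; ring.
Qed.

Lemma biquadratic_formZ a b x y :
  biquadratic_form A (a *: x) (b *: y) = a ^+ 2 * b ^+ 2 * biquadratic_form A x y.
Proof.
rewrite /biquadratic_form !mulr_sumr; apply: eq_bigr => i1 _.
rewrite !mulr_sumr; apply: eq_bigr => i2 _.
rewrite !mulr_sumr; apply: eq_bigr => j1 _.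
by rewrite !mulr_sumr; apply: eq_bigr => j2 _; rewrite !mxE; ring.
Qed.

Lemma slice1_gradientE x y i :
  (((slice1 y)^T + slice1 y) *m x) i 0 =
  \sum_(i1 < m) \sum_(j1 < n) \sum_(j2 < n)
    A i1 j1 i j2 * x i1 0 * y j1 0 * y j2 0
  + \sum_(i2 < m) \sum_(j1 < n) \sum_(j2 < n)
      A i j1 i2 j2 * y j1 0 * x i2 0 * y j2 0.
Proof.
rewrite mulmxDl mxE; congr (_ + _); rewrite mxE; apply: eq_bigr => i' _;
  rewrite ?mxE !mulr_suml; apply: eq_bigr => j1 _;
  by rewrite !mulr_suml; apply: eq_bigr => j2 _; ring.
Qed.

Lemma slice2_gradientE x y j :
  (((slice2 x)^T + slice2 x) *m y) j 0 =
  \sum_(i1 < m) \sum_(i2 < m) \sum_(j1 < n)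
    A i1 j1 i2 j * x i1 0 * y j1 0 * x i2 0
  + \sum_(i1 < m) \sum_(i2 < m) \sum_(j2 < n)
      A i1 j i2 j2 * x i1 0 * x i2 0 * y j2 0.
Proof.
rewrite mulmxDl mxE; congr (_ + _); rewrite mxE;
  under eq_bigr => j' _ do rewrite ?mxE !mulr_suml;
  rewrite exchange_big/=; apply: eq_bigr => i1 _;
  under eq_bigr => j' _ do rewrite !mulr_suml;
  rewrite exchange_big/=; apply: eq_bigr => i2 _;
  by apply: eq_bigr => j' _; ring.
Qed.

(** The M-eigenvalue equations say that [x] and [y] are critical on the unit
    spheres, each with the other fixed, with the same multiplier. *)
Lemma M_eigenpairP l x y :
  M_eigenpair A l x y <->
  [/\ unit_vector x, unit_vector y,
      ((slice1 y)^T + slice1 y) *m x = (2 * l) *: x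
    & ((slice2 x)^T + slice2 x) *m y = (2 * l) *: y].
Proof.
split=> -[x1 y1 xl yl]; split=> //.
- by apply/colP => i; rewrite slice1_gradientE xl mxE.
- by apply/colP => j; rewrite slice2_gradientE yl mxE.
- by move=> i; rewrite -slice1_gradientE xl mxE.
- by move=> j; rewrite -slice2_gradientE yl mxE.
Qed.

Lemma M_eigenpair_form l x y : M_eigenpair A l x y -> biquadratic_form A x y = l.
Proof.
case/M_eigenpairP => x1 _ xl _; rewrite -quad_slice1.
have : (x^T *m (((slice1 y)^T + slice1 y) *m x)) 0 0 = 2 * l.
  by rewrite xl -scalemxAr mxE x1 mulr1.
rewrite mulmxDl mulmxDr [X in X = _ -> _]mxE -!/(quad _ _) quad_tr; lra.
Qed.

End Slices.

(** * Existence of a minimum *)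

Section Minimum.
Local Open Scope classical_set_scope.
Context {R : realType}.

Lemma continuous_sum {T : topologicalType} {I : Type} (r : seq I) (F : I -> T -> R) :
  (forall i, continuous (F i)) -> continuous (fun t => \sum_(i <- r) F i t).
Proof. by move=> Fc; apply: continuous_big => //; exact: add_continuous. Qed.

Lemma continuous_mul {T : topologicalType} (f g : T -> R) :
  continuous f -> continuous g -> continuous (fun t => f t * g t).
Proof. by move=> fc gc t; apply: cvgM; [exact: fc|exact: gc]. Qed.

(** The unit sphere as a set of row vectors, the shape for which [rV_compact]
    gives the compactness of boxes. *)
Definition unit_sphere k : set 'rV[R]_k := [set u | unit_vector u^T].

Lemma compact_unit_sphere k : compact (unit_sphere k).
Proof.
pose box := [set u : 'rV[R]_k | forall i, `[(-1 : R), 1] (u ord0 i)].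
have cbox : compact box.
  refine (@rV_compact R k (fun=> `[(-1 : R), 1]) _) => i.
  exact: segment_compact.
apply: (subclosed_compact _ cbox).
- rewrite (_ : unit_sphere k = (fun u : 'rV[R]_k => \sum_i u 0 i * u 0 i) @^-1` [set x | x = 1]).
    apply: preimage_closed; last exact: closed_eq.
    move=> u _; move: u; apply: continuous_sum => i.
    by apply: continuous_mul => u; exact: coord_continuous.
  apply/seteqP; split=> u; rewrite /unit_sphere/= /unit_vector sqnormE => <-;
    by apply: eq_bigr => i _; rewrite mxE expr2.
- move=> u; rewrite /unit_sphere/= /unit_vector sqnormE => u1 i /=.
  rewrite in_itv/= -ler_norml -(@expr_le1 _ 2)// real_normK ?num_real// -u1.
  by rewrite (bigD1 i)//= mxE lerDl sumr_ge0// => j _; exact: sqr_ge0.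
Qed.

Lemma unit_sphere_neq0 k : (0 < k)%N -> unit_sphere k !=set0.
Proof.
move=> k0; have [a [u [u1 _]]] := scale_unit_vector (0 : 'cV[R]_k) k0.
by exists u^T; rewrite /unit_sphere/= trmxK.
Qed.

Lemma continuous_biquadratic_form m n (A : biquadratic_tensor R m n) :
  continuous (fun p : 'rV[R]_m * 'rV[R]_n => biquadratic_form A p.1^T p.2^T).
Proof.
have x_cont i : continuous (fun p : 'rV[R]_m * 'rV[R]_n => p.1^T i 0).
  under eq_fun do rewrite mxE.
  move=> p; apply: (cvg_comp fst (fun u : 'rV[R]_m => u 0 i)); first exact: cvg_fst.
  exact: coord_continuous.
have y_cont i : continuous (fun p : 'rV[R]_m * 'rV[R]_n => p.2^T i 0).
  under eq_fun do rewrite mxE.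
  move=> p; apply: (cvg_comp snd (fun u : 'rV[R]_n => u 0 i)); first exact: cvg_snd.
  exact: coord_continuous.
do 4![apply: continuous_sum => ?].
by do 4?[apply: continuous_mul => //] => p; exact: cvg_cst.
Qed.

Lemma biquadratic_form_min m n (A : biquadratic_tensor R m n) :
  (0 < m)%N -> (0 < n)%N ->
  exists x y, [/\ unit_vector x, unit_vector y
    & forall u v, unit_vector u -> unit_vector v ->
        biquadratic_form A x y <= biquadratic_form A u v].
Proof.
move=> m0 n0.
have [] := @compact_EVT_min _ R
    (fun p : 'rV[R]_m * 'rV[R]_n => biquadratic_form A p.1^T p.2^T)
    (unit_sphere m `*` unit_sphere n).
- have [u u1] := unit_sphere_neq0 m m0; have [v v1] := unit_sphere_neq0 n n0.
  by exists (u, v).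
- by apply: compact_setX; exact: compact_unit_sphere.
- by apply: continuous_subspaceT; exact: continuous_biquadratic_form.
move=> [x y] /set_mem [/= x1 y1] xy_min; exists x^T, y^T; split=> // u v u1 v1.
have := xy_min (u^T, v^T); rewrite /= !trmxK; apply.
by apply/mem_set; split; rewrite /unit_sphere/= trmxK.
Qed.

End Minimum.

(** * The smallest M-eigenvalue *)

Lemma exists_minimal_M_eigenpair {R : realType} {m n}
    (A : biquadratic_tensor R m n) : (0 < m)%N -> (0 < n)%N ->
  exists l x y, M_eigenpair A l x y /\
    forall u v, unit_vector u -> unit_vector v -> l <= biquadratic_form A u v.
Proof.
move=> m0 n0; have [x [y [x1 y1 xy_min]]] := biquadratic_form_min m n A m0 n0.
exists (biquadratic_form A x y), x, y; split=> //; apply/M_eigenpairP; split=> //.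
- apply: quad_min_eigen => // [v|]; last exact: quad_slice1.
  have [a [u [u1 ->]]] := scale_unit_vector v m0.
  rewrite quad_slice1 -[y in leRHS]scale1r biquadratic_formZ sqnormZ u1.
  by rewrite expr1n !mulr1 mulrC ler_wpM2l ?sqr_ge0 ?xy_min.
- apply: quad_min_eigen => // [v|]; last exact: quad_slice2.
  have [a [u [u1 ->]]] := scale_unit_vector v n0.
  rewrite quad_slice2 -[x in leRHS]scale1r biquadratic_formZ sqnormZ u1.
  by rewrite expr1n mul1r mulr1 mulrC ler_wpM2l ?sqr_ge0 ?xy_min.
Qed.

Theorem theorem3p1 (R : realType) (m n : nat) (hm : (2 <= m)%N) (hn : (2 <= n)%N)
    (A : biquadratic_tensor R m n) :
  [/\ exists lambda : R, M_eigenvalue A lambda,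
      positive_semidefinite A <->
        (forall lambda : R, M_eigenvalue A lambda -> 0 <= lambda)
    & positive_definite A <->
        (forall lambda : R, M_eigenvalue A lambda -> 0 < lambda)].
Proof.
have m0 := ltnW hm; have n0 := ltnW hn.
have [l [x [y [lxy l_min]]]] := exists_minimal_M_eigenpair A m0 n0.
have l_eigen : M_eigenvalue A l by exists x, y.
split; first by exists l.
- split=> [A0 k [u [v kuv]]|ge0 u v].
    by rewrite -(M_eigenpair_form A k u v kuv).
  have [a [u' [u1 ->]]] := scale_unit_vector u m0.
  have [b [v' [v1 ->]]] := scale_unit_vector v n0.
  rewrite biquadratic_formZ mulr_ge0//; first by rewrite mulr_ge0 ?sqr_ge0.
  exact: le_trans (ge0 l l_eigen) (l_min _ _ u1 v1).
- split=> [A0 k [u [v kuv]]|gt0 u v u1 v1].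
    by rewrite -(M_eigenpair_form A k u v kuv); case: kuv => u1 v1 _ _; exact: A0.
  exact: lt_le_trans (gt0 l l_eigen) (l_min _ _ u1 v1).
Qed.
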